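(* Let $\mathbb{K}$ be a field in which $3$ is invertible and let $\mathfrak{lie}_2$ be the completed free Lie algebra over $\mathbb{K}$ in two generators $x,y$. The operator $\mathcal{H}:\mathfrak{lie}_2\to\mathfrak{lie}_2$ defined by $$(\mathcal{H}\varphi)(x,y):=\tfrac13\bigl[2\varphi(x,y)-\varphi(y,-x-y)-\varphi(-x-y,x)\bigr]$$ projects onto the space of solutions of the hexagon equation, i.e. $\mathcal{H}$ is linear, $\mathcal{H}\circ\mathcal{H}=\mathcal{H}$, and the image of $\mathcal{H}$ is exactly the set of all $\phi\in\mathfrak{lie}_2$ satisfying $$\phi(x,y)+\phi(y,-x-y)+\phi(-x-y,x)=0.$$
   Context: The completed free Lie algebra $\mathfrak{lie}_2$ is the completion of the free Lie algebra on $x,y$ with respect to the degree (lower central series) filtration, i.e. the product of its homogeneous components. For $\varphi=\varphi(x,y)\in\mathfrak{lie}_2$ and $a,b$ in the $\mathbb{K}$-linear span of $x,y$, $\varphi(a,b)$ denotes the image of $\varphi$ under the continuous Lie algebra endomorphism of $\mathfrak{lie}_2$ sending $x\mapsto a$, $y\mapsto b$. *)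

(* Defs.v *)
From HB Require Import structures.
From mathcomp Require Import all_boot all_order all_algebra generic_quotient.
From mathcomp Require Import boolp classical_sets functions.

Set Implicit Arguments.
Unset Strict Implicit.
Unset Printing Implicit Defensive.

Import GRing.Theory.
Local Open Scope ring_scope.
Local Open Scope quotient_scope.

(* The bracket is required to be alternating, not merely antisymmetric: the
   base field may have characteristic 2. *)
HB.mixin Record Lmodule_isLieAlgebra (K : fieldType) L of GRing.Lmodule K L := {
  lie : L -> L -> L;
  lieDl : forall u v w, lie (u + v) w = lie u w + lie v w;
  lieDr : forall u v w, lie u (v + w) = lie u v + lie u w;
  lieZl : forall (c : K) u v, lie (c *: u) v = c *: lie u v;
  lieZr : forall (c : K) u v, lie u (c *: v) = c *: lie u v;
  liexx : forall u, lie u u = 0;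
  lie_jacobi : forall u v w,
    lie u (lie v w) + lie v (lie w u) + lie w (lie u v) = 0
}.

#[short(type="lieAlgType")]
HB.structure Definition LieAlgebra (K : fieldType) :=
  { L of Lmodule_isLieAlgebra K L & GRing.Lmodule K L }.

Definition lie_morphism (K : fieldType) (L M : lieAlgType K) (f : L -> M) :=
  linear f /\ {morph f : u v / lie u v}.

Section LieTheory.
Variables (K : fieldType) (L : lieAlgType K).
Implicit Types u v w : L.

Lemma lie0l v : lie 0 v = 0 :> L.
Proof. by have := lieZl 0 (0 : L) v; rewrite !scale0r. Qed.

Lemma lie0r u : lie u 0 = 0 :> L.
Proof. by have := lieZr 0 u (0 : L); rewrite !scale0r. Qed.

Lemma lieC u v : lie u v = - lie v u.
Proof.
apply/eqP; rewrite -addr_eq0; apply/eqP.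
by have := liexx (u + v); rewrite lieDl !lieDr !liexx add0r addr0.
Qed.

Lemma lie_sumr u (I : Type) (r : seq I) (P : pred I) (F : I -> L) :
  lie u (\sum_(i <- r | P i) F i) = \sum_(i <- r | P i) lie u (F i).
Proof.
by elim/big_rec2: _ => [|i x y _ <-]; rewrite ?lie0r ?lieDr.
Qed.

End LieTheory.

Section FreeLie.
Variables (K : fieldType) (X : Type).

Inductive lterm : Type :=
| TGen of X
| TZero
| TOpp of lterm
| TAdd of lterm & lterm
| TScale of K & lterm
| TBr of lterm & lterm.

HB.instance Definition _ := gen_eqMixin lterm.
HB.instance Definition _ := gen_choiceMixin lterm.

(* Least congruence on terms imposing exactly the Lie algebra axioms, so that
   the quotient is the Lie algebra freely generated by X: see [flift_gen],
   [flift_lie] and [flift_unique]. *)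
Inductive leqv : lterm -> lterm -> Prop :=
| leqv_refl s : leqv s s
| leqv_sym s t : leqv s t -> leqv t s
| leqv_trans s t r : leqv s t -> leqv t r -> leqv s r
| leqv_opp s s' : leqv s s' -> leqv (TOpp s) (TOpp s')
| leqv_add s s' t t' : leqv s s' -> leqv t t' -> leqv (TAdd s t) (TAdd s' t')
| leqv_scale c s s' : leqv s s' -> leqv (TScale c s) (TScale c s')
| leqv_br s s' t t' : leqv s s' -> leqv t t' -> leqv (TBr s t) (TBr s' t')
| leqv_addA s t r : leqv (TAdd s (TAdd t r)) (TAdd (TAdd s t) r)
| leqv_addC s t : leqv (TAdd s t) (TAdd t s)
| leqv_add0 s : leqv (TAdd TZero s) s
| leqv_addN s : leqv (TAdd (TOpp s) s) TZero
| leqv_scaleA c d s : leqv (TScale c (TScale d s)) (TScale (c * d) s)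
| leqv_scale1 s : leqv (TScale 1 s) s
| leqv_scaleDr c s t :
    leqv (TScale c (TAdd s t)) (TAdd (TScale c s) (TScale c t))
| leqv_scaleDl c d s : leqv (TScale (c + d) s) (TAdd (TScale c s) (TScale d s))
| leqv_brDl s t r : leqv (TBr (TAdd s t) r) (TAdd (TBr s r) (TBr t r))
| leqv_brDr s t r : leqv (TBr s (TAdd t r)) (TAdd (TBr s t) (TBr s r))
| leqv_brZl c s t : leqv (TBr (TScale c s) t) (TScale c (TBr s t))
| leqv_brZr c s t : leqv (TBr s (TScale c t)) (TScale c (TBr s t))
| leqv_brxx s : leqv (TBr s s) TZero
| leqv_jacobi s t r :
    leqv (TAdd (TAdd (TBr s (TBr t r)) (TBr t (TBr r s))) (TBr r (TBr s t)))
         TZero.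

Definition leqvb (s t : lterm) : bool := `[< leqv s t >].

Lemma leqvb_refl : reflexive leqvb.
Proof. by move=> s; apply/asboolP; apply: leqv_refl. Qed.

Lemma leqvb_sym : symmetric leqvb.
Proof. by move=> s t; apply/asboolP/asboolP; apply: leqv_sym. Qed.

Lemma leqvb_trans : transitive leqvb.
Proof.
by move=> t s r /asboolP st /asboolP tr; apply/asboolP; apply: leqv_trans st tr.
Qed.

Canonical leqvb_equiv := EquivRel leqvb leqvb_refl leqvb_sym leqvb_trans.

Definition freeLie := {eq_quot leqvb}.

HB.instance Definition _ := Choice.on freeLie.
HB.instance Definition _ := EqQuotient.on freeLie.

Definition fcls (t : lterm) : freeLie := \pi_freeLie t.

Lemma fclsP s t : fcls s = fcls t <-> leqv s t.
Proof.
split; first by move/eqmodP/asboolP.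
by move=> h; apply/eqmodP/asboolP.
Qed.

Lemma fcls_repr (u : freeLie) : fcls (repr u) = u.
Proof. exact: reprK. Qed.

Lemma repr_fcls t : leqv (repr (fcls t)) t.
Proof. by apply/fclsP; rewrite fcls_repr. Qed.

Lemma freeLieP (P : freeLie -> Prop) : (forall t, P (fcls t)) -> forall u, P u.
Proof. by move=> h u; rewrite -(fcls_repr u). Qed.

Definition fgen (i : X) : freeLie := fcls (TGen i).
Definition fzero : freeLie := fcls TZero.
Definition fopp (u : freeLie) : freeLie := fcls (TOpp (repr u)).
Definition fadd (u v : freeLie) : freeLie := fcls (TAdd (repr u) (repr v)).
Definition fscale (c : K) (u : freeLie) : freeLie := fcls (TScale c (repr u)).
Definition fbr (u v : freeLie) : freeLie := fcls (TBr (repr u) (repr v)).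

Lemma fopp_cls s : fopp (fcls s) = fcls (TOpp s).
Proof. by apply/fclsP; apply: leqv_opp; apply: repr_fcls. Qed.

Lemma fadd_cls s t : fadd (fcls s) (fcls t) = fcls (TAdd s t).
Proof. by apply/fclsP; apply: leqv_add; apply: repr_fcls. Qed.

Lemma fscale_cls c s : fscale c (fcls s) = fcls (TScale c s).
Proof. by apply/fclsP; apply: leqv_scale; apply: repr_fcls. Qed.

Lemma fbr_cls s t : fbr (fcls s) (fcls t) = fcls (TBr s t).
Proof. by apply/fclsP; apply: leqv_br; apply: repr_fcls. Qed.

Let clsE := (fadd_cls, fopp_cls, fscale_cls, fbr_cls).

Lemma faddA : associative fadd.
Proof.
elim/freeLieP=> s; elim/freeLieP=> t; elim/freeLieP=> r; rewrite !clsE.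
by apply/fclsP; apply: leqv_addA.
Qed.

Lemma faddC : commutative fadd.
Proof.
elim/freeLieP=> s; elim/freeLieP=> t; rewrite !clsE.
by apply/fclsP; apply: leqv_addC.
Qed.

Lemma fadd0 : left_id fzero fadd.
Proof.
by elim/freeLieP=> s; rewrite /fzero !clsE; apply/fclsP; apply: leqv_add0.
Qed.

Lemma faddN : left_inverse fzero fopp fadd.
Proof.
by elim/freeLieP=> s; rewrite /fzero !clsE; apply/fclsP; apply: leqv_addN.
Qed.

HB.instance Definition _ :=
  GRing.isZmodule.Build freeLie faddA faddC fadd0 faddN.

Lemma fscaleA c d u : fscale c (fscale d u) = fscale (c * d) u.
Proof.
by elim/freeLieP: u => s; rewrite !clsE; apply/fclsP; apply: leqv_scaleA.
Qed.

Lemma fscale1 : left_id 1 fscale.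
Proof. by elim/freeLieP=> s; rewrite !clsE; apply/fclsP; apply: leqv_scale1. Qed.

Lemma fscaleDr : right_distributive fscale +%R.
Proof.
move=> c; elim/freeLieP=> s; elim/freeLieP=> t; rewrite /GRing.add /= !clsE.
by apply/fclsP; apply: leqv_scaleDr.
Qed.

Lemma fscaleDl u : {morph fscale^~ u : c d / c + d}.
Proof.
move=> c d; elim/freeLieP: u => s; rewrite [in RHS]/GRing.add /= !clsE.
by apply/fclsP; apply: leqv_scaleDl.
Qed.

HB.instance Definition _ := GRing.Zmodule_isLmodule.Build K freeLie
  fscaleA fscale1 fscaleDr fscaleDl.

Lemma fclsD s t : fcls (TAdd s t) = fcls s + fcls t.
Proof. by rewrite -fadd_cls. Qed.
Lemma fcls0 : fcls TZero = 0.
Proof. by []. Qed.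
Lemma fclsN s : fcls (TOpp s) = - fcls s.
Proof. by rewrite -fopp_cls. Qed.
Lemma fclsZ c s : fcls (TScale c s) = c *: fcls s.
Proof. by rewrite -fscale_cls. Qed.

Lemma fbrDl u v w : fbr (u + v) w = fbr u w + fbr v w.
Proof.
elim/freeLieP: u => s; elim/freeLieP: v => t; elim/freeLieP: w => r.
by rewrite -fclsD !fbr_cls -fclsD; apply/fclsP; apply: leqv_brDl.
Qed.

Lemma fbrDr u v w : fbr u (v + w) = fbr u v + fbr u w.
Proof.
elim/freeLieP: u => s; elim/freeLieP: v => t; elim/freeLieP: w => r.
by rewrite -fclsD !fbr_cls -fclsD; apply/fclsP; apply: leqv_brDr.
Qed.

Lemma fbrZl (c : K) u v : fbr (c *: u) v = c *: fbr u v.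
Proof.
elim/freeLieP: u => s; elim/freeLieP: v => t.
by rewrite -fclsZ !fbr_cls -fclsZ; apply/fclsP; apply: leqv_brZl.
Qed.

Lemma fbrZr (c : K) u v : fbr u (c *: v) = c *: fbr u v.
Proof.
elim/freeLieP: u => s; elim/freeLieP: v => t.
by rewrite -fclsZ !fbr_cls -fclsZ; apply/fclsP; apply: leqv_brZr.
Qed.

Lemma fbrxx u : fbr u u = 0.
Proof.
by elim/freeLieP: u => s; rewrite fbr_cls -fcls0; apply/fclsP; apply: leqv_brxx.
Qed.

Lemma fbr_jacobi u v w :
  fbr u (fbr v w) + fbr v (fbr w u) + fbr w (fbr u v) = 0.
Proof.
elim/freeLieP: u => s; elim/freeLieP: v => t; elim/freeLieP: w => r.
by rewrite !fbr_cls -!fclsD -fcls0; apply/fclsP; apply: leqv_jacobi.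
Qed.

HB.instance Definition _ := Lmodule_isLieAlgebra.Build K freeLie
  fbrDl fbrDr fbrZl fbrZr fbrxx fbr_jacobi.

Lemma fclsB s t : fcls (TBr s t) = lie (fcls s) (fcls t).
Proof. by rewrite -fbr_cls. Qed.

Section Lift.
Variables (L : lieAlgType K) (g : X -> L).

Fixpoint leval (t : lterm) : L :=
  match t with
  | TGen i => g i
  | TZero => 0
  | TOpp s => - leval s
  | TAdd s r => leval s + leval r
  | TScale c s => c *: leval s
  | TBr s r => lie (leval s) (leval r)
  end.

Lemma leval_leqv s t : leqv s t -> leval s = leval t.
Proof.
elim=> //=.
- by move=> ? ? ? _ -> _ ->.
- by move=> ? ? _ ->.
- by move=> ? ? ? ? _ -> _ ->.
- by move=> ? ? ? _ ->.
- by move=> ? ? ? ? _ -> _ ->.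
- by move=> *; rewrite addrA.
- by move=> *; rewrite addrC.
- by move=> *; rewrite add0r.
- by move=> *; rewrite addNr.
- by move=> *; rewrite scalerA.
- by move=> *; rewrite scale1r.
- by move=> *; rewrite scalerDr.
- by move=> *; rewrite scalerDl.
- by move=> *; rewrite lieDl.
- by move=> *; rewrite lieDr.
- by move=> *; rewrite lieZl.
- by move=> *; rewrite lieZr.
- by move=> *; rewrite liexx.
- by move=> *; rewrite lie_jacobi.
Qed.

Definition flift (u : freeLie) : L := leval (repr u).

Lemma flift_cls t : flift (fcls t) = leval t.
Proof. by apply: leval_leqv; apply: repr_fcls. Qed.

Lemma flift_gen i : flift (fgen i) = g i.
Proof. exact: flift_cls. Qed.

Lemma flift_is_linear : linear flift.
Proof.
move=> c; elim/freeLieP=> s; elim/freeLieP=> t.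
by rewrite -fclsZ -fclsD !flift_cls.
Qed.

HB.instance Definition _ :=
  GRing.isLinear.Build K freeLie L *:%R flift flift_is_linear.

Lemma flift_lie : {morph flift : u v / lie u v}.
Proof.
by elim/freeLieP=> s; elim/freeLieP=> t; rewrite -fclsB !flift_cls.
Qed.

Lemma flift_unique (f : freeLie -> L) :
  lie_morphism f -> (forall i, f (fgen i) = g i) -> f =1 flift.
Proof.
move=> [flin fbrk] fg; elim/freeLieP => t; rewrite flift_cls.
have f0 : f 0 = 0.
  by have := flin (-1) 0 0; rewrite scaler0 add0r scaleN1r addNr.
have fZ c u : f (c *: u) = c *: f u.
  by have := flin c u 0; rewrite !addr0 f0 addr0.
elim: t => [i||s IH|s IHs t IHt|c s IH|s IHs t IHt] /=.
- exact: fg.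
- exact: f0.
- by rewrite fclsN -scaleN1r fZ IH scaleN1r.
- by rewrite fclsD -[fcls s]scale1r flin scale1r IHs IHt.
- by rewrite fclsZ fZ IH.
- by rewrite fclsB fbrk IHs IHt.
Qed.

End Lift.

(* [homog n] is the degree n component of freeLie: the spans of the brackets of
   n generators form the least family of subspaces containing the generators in
   degree 1 and compatible with the bracket. *)
Inductive homog : nat -> freeLie -> Prop :=
| homog_gen i : homog 1 (fgen i)
| homog0 n : homog n 0
| homogD n u v : homog n u -> homog n v -> homog n (u + v)
| homogZ n c u : homog n u -> homog n (c *: u)
| homog_lie m n u v : homog m u -> homog n v -> homog (m + n) (lie u v).

Lemma homog_sum n (I : Type) (r : seq I) (P : pred I) (F : I -> freeLie) :
  (forall i, P i -> homog n (F i)) -> homog n (\sum_(i <- r | P i) F i).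
Proof.
by move=> h; elim/big_rec: _ => [|i u Pi hu];
  [apply: homog0 | apply: homogD => //; apply: h].
Qed.

Definition clie_pred : {pred nat -> freeLie} :=
  fun f => `[< forall n, homog n (f n) >].

Fact clie_submod : GRing.submod_closed clie_pred.
Proof.
split=> [|c f g /asboolP hf /asboolP hg]; apply/asboolP=> n.
  exact: homog0.
by apply: homogD; [apply: homogZ; apply: hf | apply: hg].
Qed.

HB.instance Definition _ := GRing.isSubmodClosed.Build K _ clie_pred clie_submod.

(* The completed free Lie algebra: the product of the [homog n] over all n.
   Elements are the sequences of their homogeneous components. *)
Record clie := CLie {
  clie_val :> nat -> freeLie;
  clie_valP : clie_val \in clie_pred
}.

HB.instance Definition _ := [isSub for clie_val].
HB.instance Definition _ := [Choice of clie by <:].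
HB.instance Definition _ := [SubChoice_isSubLmodule of clie by <:].

Lemma clieP (f : clie) n : homog n (f n).
Proof. by have /asboolP := clie_valP f; apply. Qed.

Lemma clie_eq (f g : clie) : (forall n, f n = g n) -> f = g.
Proof. by move=> h; apply: val_inj; apply/funext. Qed.

Definition mkclie (f : nat -> freeLie) (hf : forall n, homog n (f n)) : clie :=
  CLie (asboolT hf : f \in clie_pred).

Lemma clieD (f g : clie) n : (f + g) n = f n + g n.
Proof. by []. Qed.
Lemma clieZ c (f : clie) n : (c *: f) n = c *: f n.
Proof. by []. Qed.
Lemma clie0 n : (0 : clie) n = 0.
Proof. by []. Qed.
Lemma clieN (f : clie) n : (- f) n = - f n.
Proof. by []. Qed.

Fact cbr_homog (f g : clie) n : homog n (\sum_(i < n.+1) lie (f i) (g (n - i)%N)).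
Proof.
apply: homog_sum => i _; have le_in : (i <= n)%N by rewrite -ltnS.
by rewrite -{1}(subnKC le_in); apply: homog_lie; apply: clieP.
Qed.

Definition cbr (f g : clie) : clie := mkclie (cbr_homog f g).

Lemma cbrE (f g : clie) n :
  cbr f g n = \sum_(i < n.+1) lie (f i) (g (n - i)%N).
Proof. by []. Qed.

Lemma cbrE2 (f g : clie) N n : (n <= N)%N ->
  cbr f g n =
  \sum_(i < N.+1) \sum_(j < N.+1 | (i + j == n)%N) lie (f i) (g j).
Proof.
move=> le_nN; rewrite cbrE.
rewrite (big_ord_widen N.+1 (fun i => lie (f i) (g (n - i)%N))) //.
rewrite big_mkcond; apply: eq_bigr => i _; case: ltnP => [lt_in|lt_ni].
  have lt_N : (n - i < N.+1)%N by rewrite ltnS (leq_trans (leq_subr _ _)).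
  rewrite (big_pred1 (Ordinal lt_N)) // => j /=.
  rewrite -val_eqE /=; apply/eqP/eqP => [<-|->]; first by rewrite addKn.
  by rewrite subnKC.
rewrite big1 // => j /eqP ijn.
by move: lt_ni; rewrite -ijn ltnNge leq_addr.
Qed.

Lemma cbrDl f g h : cbr (f + g) h = cbr f h + cbr g h.
Proof.
apply: clie_eq => n; rewrite clieD !cbrE -big_split; apply: eq_bigr => i _.
by rewrite clieD lieDl.
Qed.

Lemma cbrDr f g h : cbr f (g + h) = cbr f g + cbr f h.
Proof.
apply: clie_eq => n; rewrite clieD !cbrE -big_split; apply: eq_bigr => i _.
by rewrite clieD lieDr.
Qed.

Lemma cbrZl (c : K) f g : cbr (c *: f) g = c *: cbr f g.
Proof.
apply: clie_eq => n; rewrite clieZ !cbrE scaler_sumr; apply: eq_bigr => i _.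
by rewrite clieZ lieZl.
Qed.

Lemma cbrZr (c : K) f g : cbr f (c *: g) = c *: cbr f g.
Proof.
apply: clie_eq => n; rewrite clieZ !cbrE scaler_sumr; apply: eq_bigr => i _.
by rewrite clieZ lieZr.
Qed.

Lemma cbrxx f : cbr f f = 0.
Proof.
apply: clie_eq => n; rewrite (cbrE2 f f (leqnn n)) clie0.
pose G (i j : 'I_n.+1) : freeLie :=
  if (i + j == n)%N then lie (f i) (f j) else 0.
pose S := \sum_(i < n.+1) \sum_(j < n.+1 | (i < j)%N) G i j.
have GN i j : G j i = - G i j.
  by rewrite /G addnC; case: ifP => _; rewrite ?oppr0 // lieC.
have Gii i : G i i = 0 by rewrite /G liexx if_same.
have SN : \sum_(i < n.+1) \sum_(j < n.+1 | (j < i)%N) G i j = - S.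
  rewrite /S (exchange_big_dep xpredT) //= -sumrN; apply: eq_bigr => i _.
  by rewrite -sumrN; apply: eq_bigr => j _; rewrite GN.
transitivity (\sum_i \sum_j G i j).
  by apply: eq_bigr => i _; rewrite big_mkcond.
rewrite -[RHS](subrr S) -SN /S -big_split; apply: eq_bigr => i _ /=.
rewrite (bigID (fun j : 'I_n.+1 => (i < j)%N)) /=; congr (_ + _).
rewrite (bigD1 i) /= ?ltnn // Gii add0r; apply: eq_bigl => j.
by rewrite -leqNgt (ltn_neqAle j) andbC.
Qed.

Lemma cbr3E f g h n : cbr f (cbr g h) n =
  \sum_(i < n.+1) \sum_(j < n.+1) \sum_(k < n.+1)
    (if (i + j + k == n)%N then lie (f i) (lie (g j) (h k)) else 0).
Proof.
rewrite cbrE; apply: eq_bigr => i _; have le_in : (i <= n)%N by rewrite -ltnS.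
rewrite (cbrE2 g h (leq_subr i n)) lie_sumr; apply: eq_bigr => j _.
rewrite lie_sumr big_mkcond; apply: eq_bigr => k _.
by rewrite -(eqn_add2l i) subnKC // addnA.
Qed.

Lemma cbr_jacobi f g h :
  cbr f (cbr g h) + cbr g (cbr h f) + cbr h (cbr f g) = 0.
Proof.
apply: clie_eq => n; rewrite !clieD !cbr3E clie0.
have -> : \sum_(i < n.+1) \sum_(j < n.+1) \sum_(k < n.+1)
    (if (i + j + k == n)%N then lie (g i) (lie (h j) (f k)) else 0) =
  \sum_(i < n.+1) \sum_(j < n.+1) \sum_(k < n.+1)
    (if (i + j + k == n)%N then lie (g j) (lie (h k) (f i)) else 0).
  under eq_bigr => i _ do rewrite exchange_big.
  rewrite exchange_big /=; apply: eq_bigr => i _; apply: eq_bigr => j _.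
  by apply: eq_bigr => k _; rewrite [(j + k + i)%N]addnC addnA.
have -> : \sum_(i < n.+1) \sum_(j < n.+1) \sum_(k < n.+1)
    (if (i + j + k == n)%N then lie (h i) (lie (f j) (g k)) else 0) =
  \sum_(i < n.+1) \sum_(j < n.+1) \sum_(k < n.+1)
    (if (i + j + k == n)%N then lie (h k) (lie (f i) (g j)) else 0).
  rewrite exchange_big /=; apply: eq_bigr => i _; rewrite exchange_big /=.
  apply: eq_bigr => j _; apply: eq_bigr => k _.
  by rewrite -addnA addnC.
rewrite -!big_split big1 // => i _; rewrite -!big_split big1 // => j _.
rewrite -!big_split big1 // => k _ /=.
by case: ifP; rewrite ?addr0 // lie_jacobi.
Qed.

HB.instance Definition _ := Lmodule_isLieAlgebra.Build K clie
  cbrDl cbrDr cbrZl cbrZr cbrxx cbr_jacobi.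

Lemma clie_lieE (f g : clie) n :
  lie f g n = \sum_(i < n.+1) lie (f i) (g (n - i)%N).
Proof. by []. Qed.

Fact csingle_homog m u (hu : homog m u) n : homog n (if n == m then u else 0).
Proof. by case: eqP => [->|_] //; apply: homog0. Qed.

Definition csingle m u (hu : homog m u) : clie := mkclie (csingle_homog hu).

Definition cgen (i : X) : clie := csingle (homog_gen i).

(* Continuity for the degree filtration, i.e. for the product of the discrete
   topologies. *)
Definition deg_continuous (F : clie -> clie) : Prop :=
  forall (f : clie) (n : nat), exists m : nat, forall g : clie,
    (forall k, (k < m)%N -> g k = f k) -> forall k, (k < n)%N -> F g k = F f k.

End FreeLie.

Section Substitution.
Variable K : fieldType.

Local Notation lie2 := (clie K bool).

(* The two free generators x, y are indexed by false, true. *)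
Definition lieX : lie2 := cgen K false.
Definition lieY : lie2 := cgen K true.

Definition in_span (a : lie2) : Prop := exists p q : K, a = p *: lieX + q *: lieY.

Fact lsubst_homog (a b phi : lie2) n :
  homog n (flift (fun i : bool => if i then b 1%N else a 1%N) (phi n)).
Proof.
elim: (clieP phi n) => [i|m|m u v _ hu _ hv|m c u _ hu|m p u v _ hu _ hv].
- by rewrite flift_gen; case: i; apply: clieP.
- by rewrite linear0; apply: homog0.
- by rewrite linearD; apply: homogD.
- by rewrite linearZ; apply: homogZ.
- by rewrite flift_lie; apply: homog_lie.
Qed.

(* phi(a, b) for a, b in the span of x, y. Such a, b are concentrated in degree
   1, so the substitution preserves degrees and acts on each component through
   the endomorphism of freeLie given by a 1 and b 1; for other a, b the value
   has no meaning. [lsubstP] and [lsubst_unique] show that this is the unique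
   continuous Lie endomorphism sending x to a and y to b. *)
Definition lsubst (phi a b : lie2) : lie2 := mkclie (lsubst_homog a b phi).

Lemma lsubstE (phi a b : lie2) n : lsubst phi a b n =
  flift (fun i : bool => if i then b 1%N else a 1%N) (phi n).
Proof. by []. Qed.

Lemma in_span_deg1 (a : lie2) n : in_span a -> n != 1%N -> a n = 0.
Proof.
case=> p [q ->] /negPf n1.
by rewrite clieD !clieZ /= n1 !scaler0 addr0.
Qed.

Lemma lsubstP (a b : lie2) : in_span a -> in_span b ->
  [/\ lie_morphism (fun phi : lie2 => lsubst phi a b),
      deg_continuous (fun phi : lie2 => lsubst phi a b),
      lsubst lieX a b = a & lsubst lieY a b = b].
Proof.
move=> ha hb; split.
- split=> [c f g|f g]; apply: clie_eq => n.
    by rewrite clieD clieZ !lsubstE clieD clieZ linearP.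
  rewrite clie_lieE !lsubstE clie_lieE raddf_sum; apply: eq_bigr => i _.
  exact: flift_lie.
- by move=> f n; exists n => g gf k kn; rewrite !lsubstE gf.
- apply: clie_eq => n; rewrite lsubstE /=; case: eqP => [->|/eqP n1].
    by rewrite flift_gen.
  by rewrite linear0 in_span_deg1.
- apply: clie_eq => n; rewrite lsubstE /=; case: eqP => [->|/eqP n1].
    by rewrite flift_gen.
  by rewrite linear0 in_span_deg1.
Qed.

Lemma endo_unique (F G : lie2 -> lie2) :
  lie_morphism F -> deg_continuous F -> lie_morphism G -> deg_continuous G ->
  F lieX = G lieX -> F lieY = G lieY -> F =1 G.
Proof.
move=> [Fl Fb] Fc [Gl Gb] Gc FX FY f.
have lin0 (H : lie2 -> lie2) : linear H -> H 0 = 0.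
  by move=> Hl; have := Hl (-1) 0 0; rewrite scaler0 add0r scaleN1r addNr.
have linD (H : lie2 -> lie2) u v : linear H -> H (u + v) = H u + H v.
  by move=> Hl; have := Hl 1 u v; rewrite !scale1r.
have linZ (H : lie2 -> lie2) c u : linear H -> H (c *: u) = c *: H u.
  by move=> Hl; have := Hl c u 0; rewrite !addr0 (lin0 _ Hl) addr0.
have FG1 m u (hu : homog m u) (g : lie2) :
    (forall n, g n = if n == m then u else 0) -> F g = G g.
  elim: hu g => [i|{}m|{}m {}u v hu IHu hv IHv|{}m c {}u hu IHu
                |{}m p {}u v hu IHu hv IHv] g gE.
  - have -> : g = cgen K i by apply: clie_eq => n; rewrite gE.
    by case: i gE.
  - have -> : g = 0 by apply: clie_eq => n; rewrite gE if_same.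
    by rewrite !lin0.
  - have -> : g = csingle hu + csingle hv.
      by apply: clie_eq => n; rewrite gE clieD /=; case: eqP; rewrite ?addr0.
    by rewrite !linD // (IHu (csingle hu)) // (IHv (csingle hv)).
  - have -> : g = c *: csingle hu.
      by apply: clie_eq => n; rewrite gE clieZ /=; case: eqP; rewrite ?scaler0.
    by rewrite !linZ // (IHu (csingle hu)).
  - have -> : g = lie (csingle hu : lie2) (csingle hv : lie2).
      apply: clie_eq => n; rewrite gE clie_lieE /=.
      case: eqP => [->|nmp].
        have lt_m : (m < (m + p).+1)%N by rewrite ltnS leq_addr.
        rewrite (bigD1 (Ordinal lt_m)) //= eqxx addKn eqxx big1 ?addr0 // => i.
        by rewrite -val_eqE /= => /negPf ->; rewrite lie0l.
      rewrite big1 // => i _; have le_in : (i <= n)%N by rewrite -ltnS.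
      case: eqP => [im|_]; last by rewrite lie0l.
      case: eqP => [nip|_]; last by rewrite lie0r.
      by case: nmp; rewrite -im -nip subnKC.
    by rewrite Fb Gb (IHu (csingle hu)) // (IHv (csingle hv)).
pose tr m : lie2 := \sum_(i < m) csingle (clieP f i).
have trE m k : (k < m)%N -> tr m k = f k.
  move=> km; rewrite /tr; transitivity (\sum_(i < m) csingle (clieP f i) k).
    by elim/big_rec2: _ => [|i u v _ <-].
  rewrite (bigD1 (Ordinal km)) //= eqxx big1 ?addr0 // => i.
  by rewrite -val_eqE /= eq_sym => /negPf ->.
have FGtr m : F (tr m) = G (tr m).
  rewrite /tr; elim/big_rec: _ => [|i u _ IH]; first by rewrite !lin0.
  by rewrite !linD // IH (FG1 _ _ (clieP f i)).
apply: clie_eq => n.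
have [m1 h1] := Fc f n.+1; have [m2 h2] := Gc f n.+1.
rewrite -(h1 (tr (maxn m1 m2))) // => [|k km]; last first.
  by apply: trE; rewrite leq_max km.
rewrite -(h2 (tr (maxn m1 m2))) ?FGtr // => k km.
by apply: trE; rewrite leq_max km orbT.
Qed.

Lemma lsubst_unique (a b : lie2) (F : lie2 -> lie2) :
  in_span a -> in_span b -> lie_morphism F -> deg_continuous F ->
  F lieX = a -> F lieY = b -> forall phi, F phi = lsubst phi a b.
Proof.
move=> ha hb Fm Fc FX FY; have [Sm Sc SX SY] := lsubstP ha hb.
by apply: endo_unique => //; rewrite ?FX ?FY ?SX ?SY.
Qed.

End Substitution.

Notation lie2 K := (clie K bool).

Arguments lieX {K}.
Arguments lieY {K}.

Definition hexH (K : fieldType) (phi : lie2 K) : lie2 K :=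
  3%:R^-1 *: (2%:R *: lsubst phi lieX lieY - lsubst phi lieY (- lieX - lieY)
                                     - lsubst phi (- lieX - lieY) lieX).

Definition hexagon (K : fieldType) (phi : lie2 K) : Prop :=
  lsubst phi lieX lieY + lsubst phi lieY (- lieX - lieY)
                       + lsubst phi (- lieX - lieY) lieX = 0.

(* Main.v *)
Require Import Defs.
From HB Require Import structures.
From mathcomp Require Import all_boot all_order all_algebra.
From mathcomp Require Import boolp classical_sets.
Import GRing.Theory.
Local Open Scope ring_scope.
Local Open Scope classical_set_scope.

(** The substitution T sending x to y and y to -x-y has order 3, since it
    permutes x, y, -x-y cyclically. With S = 1 + T + T^2, the hexagon equation
    reads S phi = 0 and H = 1 - S/3. As S T = S, one has S S = 3 S, so S H = 0,
    while H fixes the kernel of S. *)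

Section HexagonProjection.
Set Implicit Arguments.
Variable K : fieldType.
Implicit Types phi a b c d : lie2 K.

Lemma lsubst_is_linear a b : linear (fun phi => lsubst phi a b).
Proof.
move=> k f g; apply: clie_eq => n.
by rewrite clieD clieZ !lsubstE clieD clieZ linearP.
Qed.

(** The identity of [freeLie] is a Lie morphism fixing both generators, so uniqueness of the lift
    applies in each degree. *)
Lemma lsubst_id phi : lsubst phi lieX lieY = phi.
Proof.
apply: clie_eq => n; rewrite lsubstE; symmetry.
apply: (flift_unique (L := freeLie K bool) (f := id)) => [|[]//].
by split.
Qed.

(** Substitution reads only the degree 1 parts of its arguments. In each degree both sides are thus
    lifts that agree on generators. *)
Lemma lsubst_comp phi a b c d :
  lsubst (lsubst phi a b) c d = lsubst phi (lsubst a c d) (lsubst b c d).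
Proof.
apply: clie_eq => n; rewrite !lsubstE.
pose g i := if i then lsubst b c d 1%N else lsubst a c d 1%N.
pose h i := if i then d 1%N else c 1%N.
pose k i := if i then b 1%N else a 1%N.
apply: (flift_unique (g := g) (f := flift h \o flift k)); last first.
  by move=> i /=; rewrite flift_gen; case: i.
by split=> [e|] u v /=; rewrite ?linearP // !flift_lie.
Qed.

Lemma in_span_lieX : in_span (lieX : lie2 K).
Proof. by exists 1, 0; rewrite scale1r scale0r addr0. Qed.

Lemma in_span_lieY : in_span (lieY : lie2 K).
Proof. by exists 0, 1; rewrite scale1r scale0r add0r. Qed.

Lemma in_span_third : in_span (- lieX - lieY : lie2 K).
Proof. by exists (-1), (-1); rewrite !scaleN1r. Qed.

Definition hexrot phi : lie2 K := lsubst phi lieY (- lieX - lieY).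

HB.instance Definition _ :=
  GRing.isLinear.Build K (lie2 K) (lie2 K) *:%R hexrot (lsubst_is_linear _ _).

Lemma hexrot_lieX : hexrot lieX = lieY.
Proof. by have [] := lsubstP in_span_lieY in_span_third. Qed.

Lemma hexrot_lieY : hexrot lieY = - lieX - lieY.
Proof. by have [] := lsubstP in_span_lieY in_span_third. Qed.

Lemma hexrot_third : hexrot (- lieX - lieY) = lieX.
Proof.
by rewrite linearB linearN /= hexrot_lieX hexrot_lieY opprB opprK addKr.
Qed.

(** Composing T with itself substitutes T y and T(-x-y), so the last term of the hexagon equation is
    T^2 phi. *)
Lemma hexrot2 phi : hexrot (hexrot phi) = lsubst phi (- lieX - lieY) lieX.
Proof.
by rewrite {2}/hexrot [LHS]lsubst_comp -!/(hexrot _) hexrot_lieY hexrot_third.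
Qed.

Lemma hexrot3 phi : hexrot (hexrot (hexrot phi)) = phi.
Proof.
rewrite hexrot2 /hexrot lsubst_comp.
have [_ _ _ ->] := lsubstP in_span_third in_span_lieX.
(* The first argument has become T^2 y = x; the second is T^2(-x-y) = T x = y. *)
suff -> : lsubst (- lieX - lieY : lie2 K) (- lieX - lieY) lieX = lieY.
  exact: lsubst_id.
by rewrite -hexrot2 hexrot_third hexrot_lieX.
Qed.

Definition hexsum phi : lie2 K := phi + hexrot phi + hexrot (hexrot phi).

Lemma hexsum_is_linear : linear hexsum.
Proof.
move=> c u v; rewrite /hexsum !linearP !scalerDr.
by rewrite (addrACA (c *: u)) [RHS]addrACA.
Qed.

HB.instance Definition _ :=
  GRing.isLinear.Build K (lie2 K) (lie2 K) *:%R hexsum hexsum_is_linear.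

(** Since T^3 = 1, precomposing with T only permutes the three summands cyclically. *)
Lemma hexsum_rot phi : hexsum (hexrot phi) = hexsum phi.
Proof. by rewrite /hexsum hexrot3 addrC addrA. Qed.

Lemma hexsum_hexsum phi : hexsum (hexsum phi) = 3%:R *: hexsum phi.
Proof.
(* Expanding the inner sum gives S S = S + S T + S T^2, and each summand equals S. *)
transitivity (hexsum phi + hexsum (hexrot phi) + hexsum (hexrot (hexrot phi))).
  by rewrite -!linearD.
by rewrite !hexsum_rot scaler_nat !mulrSr mulr0n add0r.
Qed.

Lemma hexagonE phi : hexagon phi <-> hexsum phi = 0.
Proof. by rewrite /hexagon lsubst_id -hexrot2. Qed.

Lemma hexHE phi (h3 : (3%:R : K) != 0) :
  hexH phi = phi - 3%:R^-1 *: hexsum phi.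
Proof.
(* Multiplying by 3 leaves 2 phi - T phi - T^2 phi = 3 phi - S phi, which follows from 3 = 2 + 1. *)
apply: (scalerI h3); rewrite /hexH lsubst_id -hexrot2 -/(hexrot phi).
rewrite [RHS]scalerBr !scalerA divff // !scale1r (natrD _ 2 1).
rewrite (scalerDl phi 2%:R) scale1r.
by rewrite /hexsum -[in RHS](addrA phi) [in RHS]opprD addrA addrK opprD addrA.
Qed.

Lemma hexH_hexagon phi (h3 : (3%:R : K) != 0) : hexagon (hexH phi).
Proof.
apply/hexagonE; rewrite hexHE // linearB linearZ /= hexsum_hexsum.
by rewrite scalerA mulVf // scale1r subrr.
Qed.

Lemma hexagon_hexH phi (h3 : (3%:R : K) != 0) :
  hexagon phi -> hexH phi = phi.
Proof. by move/hexagonE => S0; rewrite hexHE // S0 scaler0 subr0. Qed.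

End HexagonProjection.

Theorem proposition1p0p1 (K : fieldType) (h3 : (3%:R : K) != 0) :
  [/\ linear (@hexH K),
      forall phi : lie2 K, hexH (hexH phi) = hexH phi
    & range (@hexH K) = [set phi : lie2 K | hexagon phi]].
Proof.
split=> [c f g|phi|].
- rewrite !hexHE // linearP scalerDr opprD addrACA scalerBr.
  by rewrite !scalerA (mulrC c).
(* H phi is a solution, and H fixes solutions. *)
- by apply: hexagon_hexH => //; apply: hexH_hexagon.
- apply/seteqP; split=> phi /= => [[psi _ <-]|hphi]; first exact: hexH_hexagon.
  (* A solution is its own preimage under H. *)
  by exists phi => //; apply: hexagon_hexH.
Qed.
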